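(* Let $S\subseteq\mathbb{R}^n$ be compact and Zariski dense, and let $\Phi\colon\mathbb{R}[X_1,\ldots,X_n]\to\mathbb{R}[X_1,\ldots,X_n]$ be an $S$-nonnegativity preserver. Then the measure $\mathfrak{m}:=\mathfrak{m}_{\Phi^*}$, $A\mapsto\Phi^*_A$ $(A\in\mathcal{B}(S))$, takes only nonnegative (Borel) measurable functions on $S$ as its values, and $\Phi(p)=\int_S p\,d\mathfrak{m}$ for all $p\in\mathbb{R}[X_1,\ldots,X_n]$ in the following sense: whenever $(s_j)_j$ is a sequence of real valued step functions on $S$ with $|s_j|\le q$ on $S$ for some polynomial $q$ and all $j$, and $(s_j)_j$ converges pointwise on $S$ to $p$, then $\left(\int_S s_j\,d\mathfrak{m}\right)_j$ converges pointwise on $S$ to $\Phi(p)$. Furthermore, if a sequence of real valued step functions $(s_j)_j$ converges uniformly on $S$ to a polynomial $p$ (and such sequences exist for every $p$), then the sequence $\left(\int_S s_j\,d\mathfrak{m}\right)_j$ converges uniformly on $S$ to $\Phi(p)$.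
   Context: A linear map $\Phi$ on $\mathbb{R}[X_1,\ldots,X_n]$ is an $S$-nonnegativity preserver if $p\ge0$ on $S$ implies $\Phi(p)\ge 0$ on $S$ for all polynomials $p$. $S$ is Zariski dense if it is not contained in the zero set of a nonzero polynomial. $\mathcal{B}(S)$ is the $\sigma$-algebra of Borel subsets of $S$. For compact $S$ and each $x\in S$ there is (by Haviland's Theorem and determinacy of the moment problem on compact sets) a unique nonnegative Borel measure $\mu_x$ on $S$ with $\Phi(p)(x)=\int_S p\,d\mu_x$ for all polynomials $p$. For $A\in\mathcal{B}(S)$ define $\Phi^*_A\colon S\to[0,\infty)$, $x\mapsto\mu_x(A)$. The map $\mathfrak{m}_{\Phi^*}\colon A\mapsto\Phi^*_A$ is a function valued measure on $\mathcal{B}(S)$ (countably additive pointwise on $S$). A step function is a function $s=\sum_{i=1}^t r_i\mathds{1}_{A_i}$ with $r_i\in\mathbb{R}$ and pairwise disjoint $A_1,\ldots,A_t\in\mathcal{B}(S)$, where $\mathds{1}_A$ is the characteristic function of $A$; its integral is the function $\int_S s\,d\mathfrak{m}:=\sum_{i=1}^t r_i\,\mathfrak{m}(A_i)$ on $S$. *)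

(* Defs.v *)
From HB Require Import structures.
From mathcomp Require Import all_boot all_order all_algebra.
From mathcomp Require Import all_classical all_reals all_analysis.
From mathcomp.multinomials Require mpoly.
Import (canonicals, coercions) mpoly.
Import Order.TTheory GRing.Theory Num.Theory.
Import numFieldNormedType.Exports.

Set Implicit Arguments.
Unset Strict Implicit.
Unset Printing Implicit Defensive.

Local Open Scope classical_set_scope.
Local Open Scope ring_scope.

(* R[X_1, ..., X_n].  Only the canonical structures and coercions of [mpoly] are
   imported: its notations clash with those of the analysis library. *)
Notation mpolyR R n := (mpoly.mpoly n R).

(* R^n with its Borel sigma-algebra, as a measurable type. *)
Notation borelRn R n := (g_sigma_algebraType (@open 'rV[R]_n)).

Section Defs.
Context {R : realType} {n : nat}.
Implicit Types (S A : set (borelRn R n)) (Phi : mpolyR R n -> mpolyR R n).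

Definition peval (p : mpolyR R n) (x : 'rV[R]_n) : R :=
  mpoly.meval (fun i => x ord0 i) p.

Definition zariski_dense S : Prop :=
  forall p : mpolyR R n, (forall x, S x -> peval p x = 0) -> p = 0.

Definition nonnegativity_preserver S Phi : Prop :=
  forall p : mpolyR R n, (forall x, S x -> 0 <= peval p x) ->
    forall x, S x -> 0 <= peval (Phi p) x.

(* The members of B(S).  For Borel S (in particular for compact S) these are
   the same as the members of the sigma-algebra generated by the relatively
   open subsets of S. *)
Definition borel_subset S A : Prop := measurable A /\ A `<=` S.

(* Borel measures on S are encoded as Borel measures on R^n vanishing outside
   S.  Taking p = 1 shows that a representing measure is finite, hence that
   every polynomial is integrable when S is compact. *)
Definition represents S Phi (x : 'rV[R]_n)
    (mu : {measure set (borelRn R n) -> \bar R}) : Prop :=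
  mu (~` S) = 0%E /\
  forall p : mpolyR R n,
    (\int[mu]_(y in S) (peval p y)%:E)%E = (peval (Phi p) x)%:E.

(* mu_x: the representing measure at x; it exists and is unique for S compact,
   x in S and Phi a linear S-nonnegativity preserver.  The default value is
   only relevant outside of this situation. *)
Definition repr_measure S Phi (x : 'rV[R]_n) :
    {measure set (borelRn R n) -> \bar R} :=
  if pselect (exists mu, represents S Phi x mu) is left h
  then projT1 (cid h) else mzero.

(* m_{Phi^*} : A |-> Phi^*_A.  Functions on S are encoded as functions on R^n
   of which only the values on S are considered. *)
Definition phi_star S Phi A (x : borelRn R n) : R :=
  fine (repr_measure S Phi x A).

(* A step function on S, given with a representation \sum_i r_i 1_{A_i}. *)
Record step_function S := StepFunction {
  step_size : nat;
  step_coef : 'I_step_size -> R;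
  step_set : 'I_step_size -> set (borelRn R n);
  step_borel : forall i, borel_subset S (step_set i);
  step_disjoint : trivIset setT step_set }.

Definition step_fun S (s : step_function S) (x : borelRn R n) : R :=
  \sum_(i < step_size s) step_coef i * \1_(@step_set S s i) x.

Definition step_integral S (m : set (borelRn R n) -> borelRn R n -> R)
    (s : step_function S) (x : borelRn R n) : R :=
  \sum_(i < step_size s) step_coef i * m (@step_set S s i) x.

End Defs.

(* Main.v *)
(* For x in S, p |-> Phi(p)(x) is a positive functional L on polynomials, and
   everything reduces to an integral representation of L that depends measurably
   on x.

   Existence of mu_x (Haviland on a compact set): Hahn-Banach extends L to a
   positive functional u on all functions bounded on S, so that m(Q) = u(1_Q) is
   finitely additive.  Splitting S successively along the members of a countable
   base of boxes, and splitting the interval [0, m(S)) in parallel into pieces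
   whose lengths are the masses of the cells, sends t to a decreasing sequence of
   cells of vanishing diameter, hence to a point X(t) of S.  The image of the
   Lebesgue measure under X is countably additive, and it represents L because u
   is approximated by Riemann sums over the cells.

   Measurability of x |-> mu_x(A): the indicator of {h < c}, h a polynomial, is
   on S the bounded pointwise limit of the polynomials (1 - v^k)^(k 2^k), with v
   affine in h, 0 <= v <= 1 on S, and v < 1/2 iff h < c.  Hence mu_x(A) is a
   limit of polynomials in x when A is a finite intersection of such sets.  These
   sets form a pi-system that generates the Borel sets. *)
Require Import Defs.
From mathcomp Require Import all_boot all_order all_algebra.
From mathcomp Require Import all_classical all_reals all_analysis.
From mathcomp Require Import measurable_realfun ring lra.
From mathcomp.multinomials Require mpoly.
Import (canonicals, coercions) mpoly.
Import Order.TTheory GRing.Theory Num.Theory.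
Import numFieldNormedType.Exports.

Local Open Scope classical_set_scope.
Local Open Scope ring_scope.

Set Implicit Arguments.
Unset Strict Implicit.
Unset Printing Implicit Defensive.

(** * Evaluation of polynomials: algebraic rules, continuity, measurability, bounds on compact
    sets *)

Lemma pevalE (R : realType) n (p : mpolyR R n) x :
  peval p x = \sum_(m <- mpoly.msupp p)
    mpoly.mcoeff m p * \prod_(i < n) x ord0 i ^+ m i.
Proof. by rewrite /peval mpoly.mevalE. Qed.

Lemma pevalD (R : realType) n (p q : mpolyR R n) x :
  peval (p + q) x = peval p x + peval q x.
Proof. exact: mpoly.mevalD. Qed.

Lemma pevalB (R : realType) n (p q : mpolyR R n) x :
  peval (p - q) x = peval p x - peval q x.
Proof. exact: mpoly.mevalB. Qed.

Lemma pevalZ (R : realType) n c (p : mpolyR R n) x :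
  peval (c *: p) x = c * peval p x.
Proof. exact: mpoly.mevalZ. Qed.

Lemma pevalM (R : realType) n (p q : mpolyR R n) x :
  peval (p * q) x = peval p x * peval q x.
Proof. exact: mpoly.mevalM. Qed.

Lemma peval0 (R : realType) n x : peval (0 : mpolyR R n) x = 0.
Proof. exact: mpoly.meval0. Qed.

Lemma peval1 (R : realType) n x : peval (1 : mpolyR R n) x = 1.
Proof. exact: mpoly.meval1. Qed.

Lemma pevalC (R : realType) n c x : peval (c *: 1 : mpolyR R n) x = c.
Proof. by rewrite pevalZ peval1 mulr1. Qed.

Lemma pevalXn (R : realType) n (p : mpolyR R n) k x :
  peval (p ^+ k) x = peval p x ^+ k.
Proof. by elim: k => [|k IH]; rewrite ?peval1// !exprS pevalM IH. Qed.

Lemma peval_var (R : realType) n (i : 'I_n) x :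
  peval (mpoly.mpolyX R (mpoly.mnm1 i)) x = x ord0 i.
Proof. exact: mpoly.mevalXU. Qed.

Lemma continuous_peval (R : realType) n (p : mpolyR R n) :
  continuous (peval p).
Proof.
have -> : peval p = fun x : 'rV[R]_n =>
    \sum_(m <- mpoly.msupp p) mpoly.mcoeff m p * \prod_(i < n) x ord0 i ^+ m i.
  by apply/funext => y; exact: pevalE.
move=> x; have FF : Filter (nbhs x) := nbhs_filter x.
apply: cvg_big => [|m _]; first exact: add_continuous.
apply: cvgM; first exact: cvg_cst.
apply: cvg_big => [|i _]; first exact: mul_continuous.
apply: (@continuous_comp 'rV[R]_n R R (fun y => y ord0 i) (fun t => t ^+ m i)).
  exact: coord_continuous.
exact: exprn_continuous.
Qed.

Lemma continuous_measurable_borelRn (R : realType) n (f : 'rV[R]_n -> R) :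
  continuous f -> measurable_fun [set: borelRn R n] f.
Proof.
move=> cf; apply: (measurability _ (RGenOpens.measurableE R)).
move=> _ [_ [a [b ->]] <-]; apply: measurableI => //.
apply: sub_sigma_algebra.
apply: (@open_comp 'rV[R]_n R f); first by move=> ? _; exact: cf.
exact: interval_open.
Qed.

Lemma measurable_peval (R : realType) n (p : mpolyR R n) :
  measurable_fun [set: borelRn R n] (peval p).
Proof.
apply: continuous_measurable_borelRn => x; exact: continuous_peval.
Qed.

Lemma open_measurable_borelRn (R : realType) n (A : set (borelRn R n)) :
  @open 'rV[R]_n A -> measurable A.
Proof. exact: sub_sigma_algebra. Qed.

Lemma compact_measurable_borelRn (R : realType) n (S : set 'rV[R]_n) :
  compact S -> measurable (S : set (borelRn R n)).
Proof.
move=> cS; rewrite -[S]setCK; apply: measurableC.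
apply: open_measurable_borelRn; apply: closed_openC.
by apply: compact_closed => //; exact: norm_hausdorff.
Qed.

Lemma peval_bounded (R : realType) n (S : set 'rV[R]_n) (p : mpolyR R n) :
  compact S -> exists2 M, 0 < M & forall x, S x -> `|peval p x| <= M.
Proof.
move=> cS; have : compact (peval p @` S).
  by apply: continuous_compact => //; apply: continuous_subspaceT => x;
     exact: continuous_peval.
move=> /compact_bounded[M [_ +]] => /(_ (`|M| + 1)) h.
(* The bound is made strictly positive so that it can be divided by. *)
exists (`|M| + 1); first by rewrite ltr_wpDl.
by move=> x Sx; apply: h; [rewrite ltr_pwDr ?ler_norm|exists x].
Qed.

(** * Polynomial approximation of indicators of boxes *)

Lemma bernoulli_ineq (R : realType) (y : R) m :
  -1 <= y -> 1 + m%:R * y <= (1 + y) ^+ m.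
Proof.
move=> y1; elim: m => [|m IH]; first by rewrite mul0r addr0 expr0.
rewrite exprS; apply: (@le_trans _ _ ((1 + y) * (1 + m%:R * y))).
  rewrite -natr1; have : 0 <= m%:R * y ^+ 2 by rewrite mulr_ge0 ?sqr_ge0.
  nra.
by rewrite ler_wpM2l//; lra.
Qed.

(** With w = sqrt v, Bernoulli's inequality applied to 1/w bounds k w^k by 1/(1 - w), so k v^k = (k
    w^k) w^k is dominated by a geometric sequence. *)
Lemma cvg_natmul_expr (R : realType) (v : R) :
  0 <= v < 1 -> k%:R * v ^+ k @[k --> \oo] --> (0 : R).
Proof.
move=> /andP[v0 v1]; pose w := Num.sqrt v.
have w0 : 0 <= w by exact: sqrtr_ge0.
have vE : v = w ^+ 2 by rewrite sqr_sqrtr.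
have w1 : w < 1 by rewrite -sqrtr1 ltr_sqrt.
have kw k : k%:R * w ^+ k <= (1 - w)^-1.
  have [->|wn0] := eqVneq w 0.
    by rewrite subr0 invr1 expr0n; case: k => [|k]; rewrite ?mul0r ?mulr0.
  have wp : 0 < w by rewrite lt_def wn0.
  have := @bernoulli_ineq R (w^-1 - 1) k.
  have wV : 1 < w^-1 by rewrite invf_gt1.
  move=> /(_ _)/wrap[]; first lra.
  rewrite [1 + (_ - 1)]addrC subrK exprVn => h.
  rewrite -[leRHS]mul1r ler_pdivlMr; last lra.
  have : (k%:R * (w^-1 - 1)) * w ^+ k <= 1.
    rewrite -[leRHS](@mulVf _ (w ^+ k)) ?expf_neq0// ler_wpM2r ?exprn_ge0//; lra.
  have : 0 <= k%:R * w ^+ k by rewrite mulr_ge0 ?exprn_ge0.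
  have -> : k%:R * (w^-1 - 1) * w ^+ k = k%:R * w ^+ k * (1 - w) * w^-1.
    by field.
  move=> h1 h2; apply: le_trans h2.
  by rewrite ler_peMr// ?mulr_ge0 ?exprn_ge0//; lra.
apply: (@squeeze_cvgr _ _ _ _ (cst 0) (fun k => (1 - w)^-1 * w ^+ k)).
- near=> k; rewrite mulr_ge0 ?exprn_ge0//= vE -exprM mulnC muln2 -addnn exprD.
  by rewrite mulrA ler_wpM2r ?exprn_ge0.
- exact: cvg_cst.
- by apply: cvg_geometric; rewrite ger0_norm.
Unshelve. all: by end_near. Qed.

(** The exponent is tuned to k 2^k u^k = k (2u)^k, which tends to 0 for 0 <= u < 1/2 and is at least
    k for u >= 1/2; hence the jump at 1/2. *)
Definition spike (R : realType) k (u : R) := (1 - u ^+ k) ^+ (k * 2 ^ k).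

Lemma spike_itv (R : realType) k (u : R) : 0 <= u <= 1 -> 0 <= spike k u <= 1.
Proof.
move=> /andP[u0 u1]; have := exprn_ge0 k u0; have := exprn_ile1 k u0 u1.
by move=> h1 h0; rewrite exprn_ge0 ?exprn_ile1//; lra.
Qed.

(** For y = u^k and m = k 2^k, (1 - y)^m (1 + y)^m <= 1, while Bernoulli gives (1 + y)^m >= 1 + m y
    >= 1 + k. The factor k in m is what covers u = 1/2. *)
Lemma spike_le (R : realType) k (u : R) : 2^-1 <= u <= 1 ->
  spike k u <= k.+1%:R^-1.
Proof.
move=> /andP[u2 u1]; have u0 : 0 <= u by lra.
rewrite /spike; set y := u ^+ k; set m := (k * 2 ^ k)%N.
have y0 : 0 <= y by exact: exprn_ge0.
have y1 : y <= 1 by exact: exprn_ile1.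
have my : k%:R <= m%:R * y.
  have : 1 <= 2 ^+ k * y.
    by rewrite -exprMn exprn_ege1//; lra.
  rewrite /m natrM natrX => h; rewrite -mulrA -[leLHS]mulr1.
  exact: ler_wpM2l.
have h1 := @bernoulli_ineq R y m ltac:(lra).
have h2 : (1 - y) ^+ m * (1 + y) ^+ m <= 1.
  by rewrite -exprMn exprn_ile1//; nra.
have h3 : 0 <= (1 - y) ^+ m by apply: exprn_ge0; lra.
rewrite -[leRHS]mul1r ler_pdivlMr//; apply: le_trans h2.
by apply: ler_wpM2l => //; rewrite -natr1; lra.
Qed.

Lemma cvg_spike (R : realType) (u : R) : 0 <= u <= 1 ->
  spike k u @[k --> \oo] --> ((u < 2^-1)%R%:R : R).
Proof.
move=> u01; have /andP[u0 u1] := u01; case: ltP => u2.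
  (* The lower bound is Bernoulli's inequality at -u^k. *)
  apply: (@squeeze_cvgr _ _ _ _ (fun k => 1 - k%:R * (2 * u) ^+ k) (cst 1)).
  - near=> k; have /andP[_ ->] := spike_itv k u01; rewrite andbT.
    have := @bernoulli_ineq R (- u ^+ k) (k * 2 ^ k).
    have := exprn_ile1 k u0 u1 => h /(_ _)/wrap[]; first lra.
    by apply: le_trans; rewrite exprMn natrM natrX mulrN mulrA.
  - rewrite -[X in _ --> X](subr0 1); apply: cvgB; first exact: cvg_cst.
    by apply: cvg_natmul_expr; lra.
  - exact: cvg_cst.
apply: (@squeeze_cvgr _ _ _ _ (cst 0) (fun k => k.+1%:R^-1)).
- near=> k; have /andP[-> _] := spike_itv k u01.
  by rewrite spike_le// u2.
- exact: cvg_cst.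
- exact: cvg_harmonic.
Unshelve. all: by end_near. Qed.

(** The bounds 0 and 1 permit dominated convergence and make the class stable under products, that
    is, under intersections of sets. *)
Definition approximable (R : realType) n (S A : set 'rV[R]_n) :=
  exists2 g : nat -> mpolyR R n,
    forall k x, S x -> 0 <= peval (g k) x <= 1 &
    forall x, S x -> peval (g k) x @[k --> \oo] --> (\1_A x : R).

Lemma approximableT (R : realType) n (S : set 'rV[R]_n) : approximable S setT.
Proof.
exists (fun=> 1) => [k|] x Sx; rewrite peval1 ?ler01 ?lexx//.
by rewrite indicT; exact: cvg_cst.
Qed.

Lemma approximableI (R : realType) n (S A B : set 'rV[R]_n) :
  approximable S A -> approximable S B -> approximable S (A `&` B).
Proof.
move=> [g g01 gA] [h h01 hB]; exists (fun k => g k * h k).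
  move=> k x Sx; rewrite pevalM.
  have /andP[g0 g1] := g01 k x Sx; have /andP[h0 h1] := h01 k x Sx.
  by rewrite mulr_ge0//= mulr_ile1.
move=> x Sx; rewrite indicI /=; under eq_fun do rewrite pevalM.
by apply: cvgM; [exact: gA|exact: hB].
Qed.

Lemma approximable_lt (R : realType) n (S : set 'rV[R]_n) (h : mpolyR R n) c :
  compact S -> approximable S [set x | peval h x < c].
Proof.
move=> cS; have [M M0 hM] := @peval_bounded R n S (h - c *: 1) cS.
(* As [M] bounds |h - c| on S, [u] maps S into [0, 1], and u < 1/2 iff h < c. *)
pose u : mpolyR R n := 2^-1 *: 1 + (2 * M)^-1 *: (h - c *: 1).
have uE x : peval u x = 2^-1 + (2 * M)^-1 * (peval h x - c).
  by rewrite pevalD !pevalZ pevalB pevalC peval1 mulr1.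
have u01 x : S x -> 0 <= peval u x <= 1.
  move=> /hM; rewrite pevalB pevalC uE ler_norml invfM => /andP[h1 h2].
  set t := _ - c in h1 h2 *.
  have /andP[] : - 1 <= M^-1 * t <= 1.
    by rewrite mulrC ler_pdivrMr// ler_pdivlMr// mulN1r mul1r h1.
  lra.
exists (fun k => (1 - u ^+ k) ^+ (k * 2 ^ k)) => [k|] x Sx.
  by rewrite pevalXn pevalB peval1 pevalXn; exact/spike_itv/u01.
under eq_fun do rewrite pevalXn pevalB peval1 pevalXn.
suff -> : \1_[set x | peval h x < c] x = (peval u x < 2^-1)%R%:R :> R.
  exact/cvg_spike/u01.
rewrite indicE uE -[X in _ < X]addr0 ltrD2l pmulr_rlt0 ?invr_gt0 ?mulr_gt0//.
by rewrite subr_lt0; congr (nat_of_bool _)%:R; apply/idP/idP; rewrite inE.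
Qed.

Definition rat_box (R : realType) n (a : 'rV[rat]_n * nat) : set 'rV[R]_n :=
  [set x | forall i, `|x ord0 i - ratr (a.1 ord0 i)| < a.2.+1%:R^-1].
Arguments rat_box : clear implicits.

(** The boxes are arranged in one sequence, because [cell] splits along a sequence of sets. *)
Definition basic_box (R : realType) n (j : nat) : set 'rV[R]_n :=
  if unpickle j is Some a then rat_box R n a else set0.
Arguments basic_box : clear implicits.

Lemma ball_rVE (R : realType) n (x y : 'rV[R]_n) e : 0 < e ->
  ball x e y <-> forall i, `|x ord0 i - y ord0 i| < e.
Proof.
by move=> e0; split=> [[_ h] i|h]; [exact: h|split=> // i j; rewrite ord1; exact: h].
Qed.

Lemma open_rat_box (R : realType) n a : open (rat_box R n a).
Proof.
suff -> : rat_box R n a = ball (map_mx ratr a.1 : 'rV[R]_n) a.2.+1%:R^-1.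
  exact: ball_open.
apply/seteqP; split => x /=.
  by move=> h; apply/ball_rVE => // i; rewrite mxE distrC; exact: h.
by move/ball_rVE => h i; rewrite distrC; have := h _ i; rewrite mxE; exact.
Qed.

Lemma open_basic_box (R : realType) n j : open (basic_box R n j).
Proof.
by rewrite /basic_box; case: unpickle => [a|]; [exact: open_rat_box|exact: open0].
Qed.

Lemma basic_box_base (R : realType) n (x : 'rV[R]_n) (O : set 'rV[R]_n) :
  nbhs x O -> exists2 j, basic_box R n j x & basic_box R n j `<=` O.
Proof.
move=> /nbhs_ballP[e /= e0 xeO].
have e20 : 0 < e / 2 by rewrite divr_gt0.
(* A radius d < e/2 and a rational centre within d of x keep the box inside the ball of radius e. *)
pose N := Num.truncn (e / 2)^-1; pose d : R := N.+1%:R^-1.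
have de : d < e / 2.
  by rewrite -[ltRHS]invrK ltf_pV2 ?posrE ?invr_gt0// truncnS_gt.
have d0 : 0 < d by rewrite invr_gt0.
have /choice[q qx] : forall i : 'I_n, exists q, `|x ord0 i - ratr q| < d.
  move=> i; have [|q] := @rat_in_itvoo R (x ord0 i - d) (x ord0 i + d).
    by lra.
  by rewrite in_itv /= => qx; exists q; rewrite ltr_norml; lra.
exists (pickle (\row_i q i, N)); rewrite /basic_box pickleK /rat_box /=.
  by move=> i; rewrite mxE.
move=> y yq.
apply: xeO; apply/ball_rVE => // i; have := yq i; rewrite mxE => {}yq.
rewrite -(subrKA (ratr (q i))); apply: (le_lt_trans (ler_normD _ _)).
rewrite [e]splitr; apply: ltrD; apply: lt_trans de; first exact: qx.
by rewrite distrC.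
Qed.

(** Squaring turns |x_i - c_i| < d into a strict polynomial inequality, and a box is a finite
    intersection of these; the empty set is {0 < 0}. *)
Lemma approximable_basic_box (R : realType) n (S : set 'rV[R]_n) j :
  compact S -> approximable S (basic_box R n j).
Proof.
move=> cS; rewrite /basic_box; case: unpickle => [[c N]|]; last first.
  suff -> : set0 = [set x : 'rV[R]_n | peval 0 x < 0] by exact: approximable_lt.
  by apply/seteqP; split => x //=; rewrite peval0 ltxx.
pose d : R := N.+1%:R^-1.
pose h i : mpolyR R n := (mpoly.mpolyX R (mpoly.mnm1 i) - ratr (c ord0 i) *: 1) ^+ 2.
have hE i x : peval (h i) x < d ^+ 2 = (`|x ord0 i - ratr (c ord0 i)| < d).
  rewrite pevalXn pevalB pevalC peval_var -[_ ^+ 2]real_normK ?num_real//.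
  by rewrite ltr_pXn2r// nnegrE// invr_ge0.
have -> : rat_box R n (c, N) =
    [set x | forall i, i \in enum 'I_n -> peval (h i) x < d ^+ 2].
  apply/seteqP; split=> [x xc i _|x xc i] /=; first by rewrite hE; exact: xc.
  by rewrite -hE; apply: xc; rewrite mem_enum.
elim: (enum _) => [|i s IH].
  by rewrite [X in approximable S X](_ : _ = setT) ?predeqE//; exact: approximableT.
have -> : [set x | forall k, k \in i :: s -> peval (h k) x < d ^+ 2] =
    [set x | peval (h i) x < d ^+ 2] `&`
    [set x | forall k, k \in s -> peval (h k) x < d ^+ 2].
  apply/seteqP; split=> [x /= xis|x [/= xi xs] k]; last first.
    by rewrite inE => /predU1P[->|/xs].
  by split=> [|k ks]; apply: xis; rewrite inE ?eqxx ?ks ?orbT.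
by apply: approximableI => //; exact: approximable_lt.
Qed.

(** An open set is the countable union of the basic boxes that it contains, and these are
    approximable. *)
Lemma measurable_borelRn_approximable (R : realType) n (S : set 'rV[R]_n) :
  compact S -> @measurable _ (borelRn R n) `<=`
    <<s [set A : set (borelRn R n) | measurable A /\ approximable S A] >>.
Proof.
move=> cS; apply: smallest_sub; first exact: smallest_sigma_algebra.
move=> O oO; set G := [set A | _].
have -> : O = \bigcup_(j in [set j | basic_box R n j `<=` O]) basic_box R n j.
  apply/seteqP; split=> [x Ox|x [j /= jO jx]]; last exact: jO.
  by have [j jx jO] := @basic_box_base R n x O (open_nbhs_nbhs (conj oO Ox));
    exists j.
have sG : sigma_algebra setT <<s G >> := smallest_sigma_algebra _ _.
rewrite bigcup_mkcond; apply: sigma_algebra_bigcup => // j.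
case: ifPn => _; last exact: sigma_algebra0.
apply: sub_sigma_algebra; split; last exact: approximable_basic_box.
by apply: open_measurable_borelRn; exact: open_basic_box.
Qed.

(** * Extension of positive functionals *)

Section HahnBanach.
Variables (R : realType) (V : lmodType R) (D : set V).
Hypothesis D0 : D 0.
Hypothesis DD : forall f g, D f -> D g -> D (f + g).
Hypothesis DZ : forall (c : R) f, D f -> D (c *: f).
Implicit Types (f g : V) (q p u : V -> R).

Let DN f : D f -> D (- f).
Proof. by rewrite -scaleN1r; exact: DZ. Qed.

(** Everything is relative to the subspace [D], later the functions bounded on S inside the space of
    all functions. Homogeneity is asked as an inequality, which is easier to check for infima;
    [sublinear_onZ] recovers equality. *)
Definition sublinear_on q :=
  (forall f g, D f -> D g -> q (f + g) <= q f + q g) /\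
  (forall c f, 0 <= c -> D f -> q (c *: f) <= c * q f).

Lemma sublinear_on0 q : sublinear_on q -> q 0 = 0.
Proof.
move=> [qD qZ]; apply/eqP; rewrite eq_le; apply/andP; split.
  by have := qZ 0 0 (lexx _) D0; rewrite scale0r mul0r.
by have := qD 0 0 D0 D0; rewrite addr0; lra.
Qed.

Lemma sublinear_onN q f : sublinear_on q -> D f -> - q (- f) <= q f.
Proof.
move=> qs Df; have := qs.1 f (- f) Df (DN Df).
by rewrite subrr sublinear_on0//; lra.
Qed.

Lemma sublinear_onZ q c f : sublinear_on q -> 0 <= c -> D f ->
  q (c *: f) = c * q f.
Proof.
move=> qs; rewrite le_eqVlt => /predU1P[<-|c0] Df.
  by rewrite scale0r mul0r sublinear_on0.
have h : q f <= c^-1 * q (c *: f).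
  have := qs.2 c^-1 (c *: f).
  by rewrite invr_ge0 ltW// scalerA mulVf ?gt_eqF// scale1r => /(_ isT (DZ c Df)).
apply/eqP; rewrite eq_le; apply/andP; split; first exact: qs.2 (ltW c0) Df.
by move: h; rewrite ler_pdivlMl.
Qed.

(* A minimal sublinear functional [u] is additive: for fixed [g] the functional
   [f |-> inf_(c >= 0) (u (f + c g) - c u g)] is sublinear and at most [u]. *)
Lemma minimal_sublinear_onD u : sublinear_on u ->
  (forall q, sublinear_on q -> (forall f, D f -> q f <= u f) ->
     forall f, D f -> u f <= q f) ->
  forall f g, D f -> D g -> u (f + g) = u f + u g.
Proof.
move=> us umin f g Df Dg; apply/eqP; rewrite eq_le us.1//=.
pose F h (c : R) := u (h + c *: g) - c * u g.
pose q h := inf [set F h c | c in [set c | 0 <= c]].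
have Flb h c : D h -> 0 <= c -> - u (- h) <= F h c.
  move=> Dh c0; have := us.1 (h + c *: g) (- h) (DD Dh (DZ c Dg)) (DN Dh).
  by rewrite addrAC subrr add0r sublinear_onZ// /F; lra.
have q_le h c : D h -> 0 <= c -> q h <= F h c.
  move=> Dh c0; apply: ge_inf; last by exists c.
  by exists (- u (- h)) => _ [b b0 <-]; exact: Flb.
have le_q h z : (forall c, 0 <= c -> z <= F h c) -> z <= q h.
  move=> hz; apply: lb_le_inf; first by exists (F h 0); exists 0 => //=.
  by move=> _ [c c0 <-]; exact: hz.
have qu h : D h -> q h <= u h.
  by move=> Dh; have := q_le h 0 Dh (lexx _); rewrite /F scale0r addr0; lra.
have qs : sublinear_on q.
  split=> [h k Dh Dk|c h c0 Dh].
    (* Taking both infima reduces subadditivity to single parameters a and b, for which a + b is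
       used on the left. *)
    suff H a b : 0 <= a -> 0 <= b -> q (h + k) <= F h a + F k b.
      rewrite -lerBlDr; apply: (le_q _) => a a0; rewrite lerBlDr [leRHS]addrC -lerBlDr.
      by apply: (le_q _) => b b0; rewrite lerBlDr [leRHS]addrC; exact: H.
    move=> a0 b0; apply: (le_trans (q_le _ (a + b) _ _)); [exact: DD|lra|].
    have := us.1 (h + a *: g) (k + b *: g) (DD Dh (DZ a Dg)) (DD Dk (DZ b Dg)).
    by rewrite addrACA -scalerDl /F; lra.
  move: c0; rewrite le_eqVlt => /predU1P[<-|c0].
    by rewrite scale0r mul0r -(sublinear_on0 us); exact: qu.
  rewrite mulrC -ler_pdivrMr//; apply: (le_q _) => a a0.
  rewrite ler_pdivrMr// mulrC.
  apply: (le_trans (q_le _ (c * a) (DZ c Dh) _)); first by rewrite mulr_ge0// ltW.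
  have := sublinear_onZ us (ltW c0) (DD Dh (DZ a Dg)).
  by rewrite scalerDr scalerA /F => ->; lra.
(* By minimality u f <= q f, and the parameter c = 1 gives q f <= u (f + g) - u g. *)
have := umin q qs qu f Df; have := q_le f 1 Df ler01.
by rewrite /F scale1r mul1r; lra.
Qed.

(** Zorn's lemma yields a minimal sublinear functional below [p], since a chain is bounded below by
    its pointwise infimum; minimality makes it additive, hence linear. *)
Lemma hahn_banach p : sublinear_on p ->
  exists u, [/\ forall f, D f -> u f <= p f,
    forall f g, D f -> D g -> u (f + g) = u f + u g &
    forall c f, D f -> u (c *: f) = c * u f].
Proof.
move=> ps.
pose T := {u : V -> R | sublinear_on u /\ forall f, D f -> u f <= p f}.
(* The order is reversed, so that maximal means minimal. It is only a preorder, as values outside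
   [D] are ignored. *)
pose r (s t : T) := `[< forall f, D f -> projT1 t f <= projT1 s f >].
have pT : sublinear_on p /\ forall f, D f -> p f <= p f by split.
have [||A totA|[u [us up]] umin] := @ZL_preorder T (exist _ p pT) r.
- by move=> t; apply/asboolP.
- move=> a b c /asboolP ab /asboolP bc; apply/asboolP => f Df.
  exact: le_trans (bc f Df) (ab f Df).
- have [[a Aa]|A0] := pselect (exists a, A a); last first.
    by exists (exist _ p pT) => s As; case: A0; exists s.
  pose q f := inf [set projT1 s f | s in A].
  have q_le s f : A s -> D f -> q f <= projT1 s f.
    move=> As Df; apply: ge_inf; last by exists s.
    exists (- p (- f)) => _ [[v [vs vp]] Av <-] /=.
    apply: le_trans (sublinear_onN vs Df).
    by rewrite lerN2; exact/vp/DN.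
  have le_q f z : (forall s, A s -> z <= projT1 s f) -> z <= q f.
    move=> hz; apply: lb_le_inf; first by exists (projT1 a f); exists a.
    by move=> _ [s As <-]; exact: hz.
  have qs : sublinear_on q.
    split=> [f g Df Dg|c f c0 Df].
      suff H s t : A s -> A t -> q (f + g) <= projT1 s f + projT1 t g.
        rewrite -lerBlDr; apply: (le_q _) => s As; rewrite lerBlDr [leRHS]addrC -lerBlDr.
        by apply: (le_q _) => t At; rewrite lerBlDr [leRHS]addrC; exact: H.
      (* The infimum is subadditive because the smaller of [s] and [t] can be used for both
         terms. *)
      move=> As At; have [/asboolP st|/asboolP ts] := totA s t As At.
        apply: (le_trans (q_le t _ At (DD Df Dg))).
        apply: (le_trans ((projT2 t).1.1 _ _ Df Dg)).
        by rewrite lerD2r; exact: st.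
      apply: (le_trans (q_le s _ As (DD Df Dg))).
      apply: (le_trans ((projT2 s).1.1 _ _ Df Dg)).
      by rewrite lerD2l; exact: ts.
    move: c0; rewrite le_eqVlt => /predU1P[<-|c0].
      rewrite scale0r mul0r; apply: (le_trans (q_le a _ Aa D0)).
      by rewrite (sublinear_on0 (projT2 a).1).
    rewrite mulrC -ler_pdivrMr//; apply: (le_q _) => s As.
    rewrite ler_pdivrMr// mulrC; apply: (le_trans (q_le s _ As (DZ c Df))).
    by rewrite (sublinear_onZ (projT2 s).1)// ltW.
  have qp f : D f -> q f <= p f.
    by move=> Df; exact: le_trans (q_le a f Aa Df) ((projT2 a).2 f Df).
  exists (exist _ q (conj qs qp)) => s As; apply/asboolP => f Df /=.
  exact: q_le.
have uD : forall f g, D f -> D g -> u (f + g) = u f + u g.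
  apply: minimal_sublinear_onD => // q qs qu f Df.
  have qp g : D g -> q g <= p g by move=> Dg; exact: le_trans (qu g Dg) (up g Dg).
  have /asboolP uq := umin (exist _ q (conj qs qp)) (asboolT qu).
  exact: uq.
exists u; split=> // c f Df.
(* For c < 0, additivity gives u (c f) = - u (- c f). *)
have [c0|c0] := leP 0 c; first exact: sublinear_onZ.
have := uD (c *: f) (- c *: f) (DZ c Df) (DZ _ Df).
rewrite -scalerDl subrr scale0r (sublinear_on0 us).
by rewrite (@sublinear_onZ u (- c))//; lra.
Qed.

End HahnBanach.

Definition bounded_on (R : realType) T (S : set T) (f : T -> R) :=
  exists M, forall x, S x -> `|f x| <= M.

Lemma bounded_on_cst (R : realType) T (S : set T) (c : R) :
  bounded_on S (fun=> c).
Proof. by exists `|c|. Qed.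

Lemma bounded_onD (R : realType) T (S : set T) (f g : T -> R) :
  bounded_on S f -> bounded_on S g -> bounded_on S (f + g).
Proof.
move=> [M fM] [N gN]; exists (M + N) => x Sx.
by apply: (le_trans (ler_normD _ _)); apply: lerD; [exact: fM|exact: gN].
Qed.

Lemma bounded_onM (R : realType) T (S : set T) (f g : T -> R) :
  bounded_on S f -> bounded_on S g -> bounded_on S (f * g).
Proof.
move=> [M fM] [N gN]; exists (M * N) => x Sx.
by rewrite normrM; apply: ler_pM => //; [exact: fM|exact: gN].
Qed.

Lemma bounded_onZ (R : realType) T (S : set T) c (f : T -> R) :
  bounded_on S f -> bounded_on S (c *: f).
Proof. exact: (bounded_onM (bounded_on_cst S c)). Qed.

Lemma bounded_on_indic (R : realType) T (S A : set T) :
  bounded_on S (\1_A : T -> R).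
Proof. by exists 1 => x _; rewrite indicE; case: (_ \in _); rewrite ?normr1 ?normr0. Qed.

Lemma bounded_on_peval (R : realType) n (S : set 'rV[R]_n) (p : mpolyR R n) :
  compact S -> bounded_on S (peval p).
Proof. by move=> /(peval_bounded p)[M _ pM]; exists M. Qed.

Section PositiveExtension.
Variables (R : realType) (n : nat) (S : set 'rV[R]_n) (L : mpolyR R n -> R).
Hypothesis cS : compact S.
Hypothesis LD : forall p q, L (p + q) = L p + L q.
Hypothesis LZ : forall c p, L (c *: p) = c * L p.
Hypothesis Lpos : forall p, (forall x, S x -> 0 <= peval p x) -> 0 <= L p.

Lemma positive_le p q : (forall x, S x -> peval p x <= peval q x) -> L p <= L q.
Proof.
move=> pq; have := @Lpos (q - p).
rewrite -scaleN1r LD LZ mulN1r subr_ge0; apply => x Sx.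
by rewrite scaleN1r pevalB subr_ge0; exact: pq.
Qed.

(** Let p f be the infimum of L q over polynomials q >= f on S; constants show that it is finite. A
    linear u <= p is positive because p (- f) <= L 0 = 0 for f >= 0, and it extends [L] because u q
    <= L q and u (- q) <= L (- q). *)
Lemma positive_extension : exists u : ('rV[R]_n -> R) -> R,
  [/\ forall f g, bounded_on S f -> bounded_on S g -> u (f + g) = u f + u g,
      forall c f, bounded_on S f -> u (c *: f) = c * u f,
      forall f, bounded_on S f -> (forall x, S x -> 0 <= f x) -> 0 <= u f &
      forall p, u (peval p) = L p].
Proof.
pose P f := [set q : mpolyR R n | forall x, S x -> f x <= peval q x].
pose p f := inf [set L q | q in P f].
have p_le f q : bounded_on S f -> P f q -> p f <= L q.
  move=> [M fM] fq; apply: ge_inf; last by exists q.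
  exists (L (- M *: 1)) => _ [k fk <-]; apply: positive_le => x Sx.
  rewrite pevalC; apply: le_trans (fk x Sx).
  by have := fM x Sx; rewrite ler_norml => /andP[].
have le_p f z : bounded_on S f -> (forall q, P f q -> z <= L q) -> z <= p f.
  move=> [M fM] hz; apply: lb_le_inf; last by move=> _ [s As <-]; exact: hz.
  exists (L (M *: 1)); exists (M *: 1) => // x Sx; rewrite pevalC.
  exact: le_trans (ler_norm _) (fM x Sx).
have bS := bounded_on_peval _ cS.
have ps : sublinear_on (bounded_on S) p.
  split=> [f g Df Dg|c f c0 Df].
    suff H a b : P f a -> P g b -> p (f + g) <= L a + L b.
      rewrite -lerBlDr; apply: (le_p _) => // a fa; rewrite lerBlDr [leRHS]addrC -lerBlDr.
      by apply: (le_p _) => // b gb; rewrite lerBlDr [leRHS]addrC; exact: H.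
    move=> fa gb; rewrite -LD; apply: p_le; first exact: bounded_onD.
    by move=> x Sx; rewrite pevalD; apply: lerD; [exact: fa|exact: gb].
  have pc a : P f a -> p (c *: f) <= c * L a.
    move=> fa; rewrite -LZ; apply: p_le; first exact: bounded_onZ.
    by move=> x Sx; rewrite pevalZ; apply: ler_wpM2l => //; exact: fa.
  move: c0; rewrite le_eqVlt => /predU1P[c0|c0]; last first.
    rewrite mulrC -ler_pdivrMr//; apply: (le_p _) => // a fa.
    by rewrite ler_pdivrMr// mulrC; exact: pc.
  (* For c = 0 one polynomial majorant of f is needed: the constant [M]. *)
  have [M fM] := Df; have := pc (M *: 1); rewrite -c0 !mul0r; apply=> x Sx.
  by rewrite pevalC; exact: le_trans (ler_norm _) (fM x Sx).
have [|||u [up uD uZ]] := hahn_banach _ _ _ ps.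
- exact: (bounded_on_cst S 0).
- exact: bounded_onD.
- exact: bounded_onZ.
have uN f : bounded_on S f -> u (- f) = - u f.
  by move=> Df; rewrite -scaleN1r uZ// mulN1r.
have bN (f : 'rV[R]_n -> R) : bounded_on S f -> bounded_on S (- f).
  by rewrite -scaleN1r; exact: bounded_onZ.
exists u; split=> // [f Df f0|q].
  rewrite -[u f]opprK -uN// oppr_ge0.
  apply: (le_trans (up _ (bN _ Df))).
  have <- : L (0 *: 0) = 0 by rewrite LZ mul0r.
  apply: p_le; first exact: bN.
  by move=> x Sx; rewrite pevalZ mul0r oppr_le0; exact: f0.
apply/eqP; rewrite eq_le; apply/andP; split.
  by apply: (le_trans (up _ (bS q))); apply: p_le.
rewrite -[u _]opprK lerNr -uN//; apply: (le_trans (up _ (bN _ (bS q)))).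
rewrite -[- L q]mulN1r -LZ; apply: p_le; first exact: bN.
by move=> x Sx; rewrite pevalZ mulN1r.
Qed.

End PositiveExtension.

(** * Measures from finitely additive set functions *)

Section Cells.
Variables (R : realType) (E : Type) (B : nat -> set E) (m : set E -> R).
Hypothesis m_ge0 : forall Q, 0 <= m Q.
Hypothesis m_split : forall Q A, m Q = m (Q `&` A) + m (Q `\` A).

(* The interval [lo, lo + m Q) is cut into one piece of length [m Q'] for each
   of the cells Q' that [B i], ..., [B (i + k - 1)] carve out of [Q]; [cell] is
   the cell attached to the piece containing [t]. *)
Fixpoint cell k i (Q : set E) (lo t : R) : set E :=
  if k is k'.+1 then
    if t < lo + m (Q `&` B i) then cell k' i.+1 (Q `&` B i) lo t
    else cell k' i.+1 (Q `\` B i) (lo + m (Q `&` B i)) t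
  else Q.

Definition resolved i k Q :=
  forall j, (i <= j < i + k)%N -> Q `<=` B j \/ Q `&` B j = set0.

Lemma cell_sub k i Q lo t : cell k i Q lo t `<=` Q.
Proof.
elim: k i Q lo => [|k IH] i Q lo; first by [].
rewrite [cell _ _ _ _ _]/=; case: (t < _).
  by apply: (subset_trans (IH _ _ _)); exact: subIsetl.
by apply: (subset_trans (IH _ _ _)); exact: subDsetl.
Qed.

Lemma cellS_sub k i Q lo t : cell k.+1 i Q lo t `<=` cell k i Q lo t.
Proof.
elim: k i Q lo => [|k IH] i Q lo; first exact: cell_sub.
by rewrite [cell k.+2 _ _ _ _]/= [cell k.+1 i Q _ _]/=; case: ifP => _; exact: IH.
Qed.

Lemma cell_homo k l i Q lo t : (k <= l)%N -> cell l i Q lo t `<=` cell k i Q lo t.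
Proof.
move=> /subnK <-; elim: (l - k)%N => [|d IH]; first by rewrite add0n.
by rewrite addSn; apply: subset_trans IH; exact: cellS_sub.
Qed.

(** The hypothesis, that t lies in the piece attached to the current cell, is preserved by each cut.
    It guarantees that the selected cells are nonempty. *)
Lemma cell_gt0 k i Q lo t : lo <= t < lo + m Q -> 0 < m (cell k i Q lo t).
Proof.
elim: k i Q lo => [|k IH] i Q lo /andP[t1 t2] /=; first by lra.
have := m_split Q (B i).
by case: (ltP t) => t3 mQ; apply: IH; apply/andP; split=> //; lra.
Qed.

Lemma cell_resolved k i Q lo t : resolved i k (cell k i Q lo t).
Proof.
elim: k i Q lo => [|k IH] i Q lo j.
  by rewrite addn0 => /andP[ij /(leq_ltn_trans ij)]; rewrite ltnn.
rewrite addnS -addSn => /andP[]; rewrite leq_eqVlt => /predU1P[<- _|ij jk].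
  rewrite /=; case: ifP => _.
    by left; apply: (subset_trans (@cell_sub _ _ _ _ _)) => x [].
  right; apply/seteqP; split => x // [/cell_sub[_ + ?]].
  exact.
by rewrite /=; case: ifP => _; apply: IH; rewrite ij jk.
Qed.

(** At fixed depth the cell takes finitely many values, selected by comparing t with constants, so
    [F] can be arbitrary. *)
Lemma measurable_fun_cell k i Q lo (F : set E -> R) :
  measurable_fun setT (fun t => F (cell k i Q lo t)).
Proof.
elim: k i Q lo => [|k IH] i Q lo /=; first exact: measurable_cst.
under eq_fun do rewrite fun_if.
by apply: measurable_fun_ifT => //; apply: measurable_fun_ltr.
Qed.

Lemma lebesgue_measure_cell (a b : R) : 0 <= b ->
  lebesgue_measure (`[a, a + b[%classic : set R) = b%:E.
Proof.
move=> b0; rewrite lebesgue_measure_itv /= lte_fin; case: ltP => ab.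
  by rewrite -EFinD; congr EFin; lra.
by congr EFin; lra.
Qed.

(** The integral is the Riemann sum of F Q' m Q' over the cells of depth k. Both [nu] and [m] are
    additive, so the local errors add up to at most e m Q. *)
Lemma integral_cell k i Q lo (F nu : set E -> R) e :
  (forall Q A, nu Q = nu (Q `&` A) + nu (Q `\` A)) ->
  (forall Q', Q' `<=` Q -> resolved i k Q' ->
     `|F Q' * m Q' - nu Q'| <= e * m Q') ->
  exists2 r, (\int[lebesgue_measure]_(t in `[lo, (lo + m Q)%R[)
      (F (cell k i Q lo t))%:E)%E = r%:E & `|r - nu Q| <= e * m Q.
Proof.
move=> nuD; elim: k i Q lo => [|k IH] i Q lo FQ /=.
  exists (F Q * m Q); last first.
    apply: FQ => // j; rewrite addn0 => /andP[ij /(leq_ltn_trans ij)].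
    by rewrite ltnn.
  rewrite integral_cst// EFinM; congr (_ * _)%E.
  exact: lebesgue_measure_cell.
set c := lo + m (Q `&` B i).
(* Subsets of either half already resolve [B i], so both halves inherit the local estimate. *)
have H Q1 : Q1 `<=` Q -> Q1 `<=` B i \/ Q1 `&` B i = set0 -> forall Q',
    Q' `<=` Q1 -> resolved i.+1 k Q' -> `|F Q' * m Q' - nu Q'| <= e * m Q'.
  move=> Q1Q Q1B Q' Q'Q1 rQ'; apply: FQ => [|j]; first exact: subset_trans Q1Q.
  rewrite addnS -addSn => /andP[]; rewrite leq_eqVlt => /predU1P[<- _|ij jk].
    case: Q1B => [h|h]; first by left; exact: subset_trans h.
    by right; apply/seteqP; split=> // x [/Q'Q1 ? ?]; rewrite -h.
  by apply: rQ'; rewrite ij jk.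
have [|r1 r1E r1e] := IH i.+1 (Q `&` B i) lo.
  by apply: H; [exact: subIsetl|left; exact: subIsetr].
have [|r2 r2E r2e] := IH i.+1 (Q `\` B i) c.
  by apply: H; [exact: subDsetl|right; rewrite setDE -setIA setICl setI0].
have mQ := m_split Q (B i); have m1 := m_ge0 (Q `&` B i).
have m2 := m_ge0 (Q `\` B i).
have cE : lo + m Q = c + m (Q `\` B i) by rewrite /c; lra.
exists (r1 + r2); last first.
  rewrite (nuD Q (B i)) mQ mulrDr opprD addrACA.
  by apply: (le_trans (ler_normD _ _)); apply: lerD.
rewrite cE (@itv_bndbnd_setU _ _ (BLeft lo) (BLeft c)) ?bnd_simp; last 2 first.
- by rewrite /c; lra.
- by lra.
rewrite integral_setU//; last 2 first.
- apply: measurable_funTS; apply/measurable_EFinP.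
  under eq_fun do rewrite fun_if.
  apply: measurable_fun_ifT; [exact: measurable_fun_ltr|exact: measurable_fun_cell|].
  exact: measurable_fun_cell.
- apply/disj_setPS => t [/=]; rewrite !in_itv /= => /andP[_ t1] /andP[t2 _].
  by move: (lt_le_trans t1 t2); rewrite ltxx.
rewrite EFinD; congr (_ + _)%E.
  rewrite -r1E; apply: eq_integral => t; rewrite inE /= in_itv /= => /andP[_ tc].
  by rewrite tc.
rewrite -r2E; apply: eq_integral => t; rewrite inE /= in_itv /= => /andP[tc _].
by rewrite ltNge tc.
Qed.

End Cells.

(** * Tools on integration, measurability and finite covers *)

Lemma integral_mrestr d (T : measurableType d) (R : realType)
    (mu : {measure set T -> \bar R}) (D : set T) (mD : measurable D)
    (f : T -> \bar R) : measurable_fun setT f ->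
  (\int[mrestr mu mD]_x f x = \int[mu]_(x in D) f x)%E.
Proof.
move=> mf; rewrite -(setvU D) integral_setU ?setvU//; last 2 first.
- exact: measurableC.
- by apply/disj_setPS; rewrite setICl.
rewrite null_set_integral ?add0e//; last 3 first.
- exact: measurableC.
- exact: measurable_funTS.
- by rewrite /= /mrestr setICl measure0.
by apply: eq_measure_integral => A mA AD; rewrite /= /mrestr setIidl.
Qed.

(** The preimage of an open set is a countable union of preimages of boxes, each given by finitely
    many conditions on coordinates. *)
Lemma measurable_fun_borelRn d (T : measurableType d) (R : realType) n
    (X : T -> borelRn R n) :
  (forall i, measurable_fun setT (fun t => (X t : 'rV[R]_n) ord0 i)) ->
  measurable_fun setT X.
Proof.
move=> mX; apply: (@measurability _ _ _ _ setT X (@open 'rV[R]_n)) => //.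
move=> _ [U oU <-]; rewrite setTI.
have -> : X @^-1` U = \bigcup_(j in [set j | basic_box R n j `<=` U])
    X @^-1` basic_box R n j.
  apply/seteqP; split=> [t Ut|t [j /= jU jx]]; last exact: jU.
  have [j jx jU] := @basic_box_base R n (X t) U (open_nbhs_nbhs (conj oU Ut)).
  by exists j.
apply: bigcup_measurable => j _; rewrite /basic_box.
case: unpickle => [a|]; last by rewrite preimage_set0.
have -> : X @^-1` rat_box R n a =
    [set t | forall i, i \in enum 'I_n ->
       `|(X t : 'rV[R]_n) ord0 i - ratr (a.1 ord0 i)| < a.2.+1%:R^-1].
  apply/seteqP; split=> [t xa i _|t xa i] /=; first exact: xa.
  by apply: xa; rewrite mem_enum.
elim: (enum _) => [|i s IH].
  by rewrite [X in measurable X](_ : _ = setT) ?predeqE.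
have -> : [set t | forall k, k \in i :: s ->
      `|(X t : 'rV[R]_n) ord0 k - ratr (a.1 ord0 k)| < a.2.+1%:R^-1] =
    (setT `&` (fun t => `|(X t : 'rV[R]_n) ord0 i - ratr (a.1 ord0 i)|) @^-1`
      `]-oo, a.2.+1%:R^-1[) `&`
    [set t | forall k, k \in s ->
      `|(X t : 'rV[R]_n) ord0 k - ratr (a.1 ord0 k)| < a.2.+1%:R^-1].
  apply/seteqP; split=> [t /= xis|t [/= [_ +] xs] k]; last first.
    by rewrite in_itv /= => xi; rewrite inE => /predU1P[->|/xs].
  split=> [|k ks]; last by apply: xis; rewrite inE ks orbT.
  by split=> //; rewrite in_itv /=; apply: xis; rewrite inE eqxx.
apply: measurableI => //.
have mf : measurable_fun setT
    (fun t => `|(X t : 'rV[R]_n) ord0 i - ratr (a.1 ord0 i)|).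
  by apply: measurableT_comp => //; apply: measurable_funB.
exact: mf.
Qed.

(** The finite subcover is recorded by a bound on its indices: cells of depth at least [K] resolve
    all boxes of index below [K]. *)
Lemma compact_basic_box (R : realType) n (S : set 'rV[R]_n) (G : set nat) :
  compact S ->
  (forall x, S x -> exists2 j, G j & basic_box R n j x) ->
  exists K, forall x, S x -> exists j, [/\ (j < K)%N, G j & basic_box R n j x].
Proof.
rewrite compact_cover => cS SG.
have [|D DG SD] := cS nat G (basic_box R n) (fun j _ => @open_basic_box R n j).
  by move=> x /SG[j Gj jx]; exists j.
exists (\max_(j <- finmap.enum_fset D) j).+1 => x /SD[j Dj jx]; exists j; split=> //.
  by rewrite ltnS; exact: (@leq_bigmax_seq _ _ xpredT id).
by have := DG _ Dj; rewrite inE.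
Qed.

Lemma bounded_integrable d (T : measurableType d) (R : realType)
    (mu : {measure set T -> \bar R}) (D : set T) (f : T -> R) M :
  measurable D -> (mu D < +oo)%E -> measurable_fun D f ->
  (forall x, D x -> `|f x| <= M) -> mu.-integrable D (EFin \o f).
Proof.
move=> mD Dfin mf fM; apply: measurable_bounded_integrable => //.
by exists M; split=> [|N MN x Dx]; [exact: num_real|exact: le_trans (fM x Dx) (ltW MN)].
Qed.

Lemma bounded_cvg_integral d (T : measurableType d) (R : realType)
    (mu : {measure set T -> \bar R}) (D : set T) (f_ : nat -> T -> R)
    (f : T -> R) M :
  measurable D -> (mu D < +oo)%E -> (forall k, measurable_fun D (f_ k)) ->
  (forall k x, D x -> `|f_ k x| <= M) ->
  (forall x, D x -> f_ k x @[k --> \oo] --> f x) ->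
  (\int[mu]_(x in D) (f_ k x)%:E @[k --> \oo] --> \int[mu]_(x in D) (f x)%:E)%E.
Proof.
move=> mD Dfin mf fM ff.
apply: (@dominated_cvg _ _ _ mu D mD _ _ (cst M%:E)) => //.
- by move=> k; apply/measurable_EFinP; exact: mf.
- by move=> x Dx; apply: cvg_EFin; [exact: nearW|exact: ff].
- by apply: (@bounded_integrable _ _ _ mu D (cst M) `|M|) => //.
Qed.

Lemma pushforward_measure d d' (T : measurableType d) (U : measurableType d')
    (R : realType) (mu : {measure set T -> \bar R}) (X : T -> U) :
  measurable_fun setT X ->
  exists nu : {measure set U -> \bar R},
    nu = pushforward mu X :> (set U -> \bar R).
Proof. by move=> mX; eexists; exact: erefl. Qed.

(** * A representing measure for a positive functional on a compact set *)

Section Haviland.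
Variables (R : realType) (n : nat) (S : set 'rV[R]_n) (L : mpolyR R n -> R).
Hypothesis cS : compact S.
Hypothesis LD : forall p q, L (p + q) = L p + L q.
Hypothesis LZ : forall c p, L (c *: p) = c * L p.
Hypothesis Lpos : forall p, (forall x, S x -> 0 <= peval p x) -> 0 <= L p.

Lemma haviland : S !=set0 -> exists mu : {measure set (borelRn R n) -> \bar R},
  mu (~` S) = 0%E /\
  forall p, (\int[mu]_(y in S) (peval p y)%:E)%E = (L p)%:E.
Proof.
move=> [a0 Sa0].
have [u [uD uZ u0 uL]] := positive_extension cS LD LZ Lpos.
have bI A : bounded_on S (\1_A : 'rV[R]_n -> R) := bounded_on_indic R S A.
have bp (p : mpolyR R n) := bounded_on_peval p cS.
have u_le (f g : 'rV[R]_n -> R) : bounded_on S f -> bounded_on S g ->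
    (forall x, S x -> f x <= g x) -> u f <= u g.
  move=> bf bg fg; have bNf := bounded_onZ (-1) bf.
  have := u0 _ (bounded_onD bg bNf).
  rewrite uD// uZ// mulN1r subr_ge0; apply => x Sx.
  by rewrite [leRHS]/(g x + (-1) * f x) mulN1r subr_ge0; exact: fg.
have u_eq (f g : 'rV[R]_n -> R) : bounded_on S f -> bounded_on S g ->
    (forall x, S x -> f x = g x) -> u f = u g.
  by move=> bf bg fg; apply/eqP; rewrite eq_le !u_le// => x /fg ->.
pose m (Q : set 'rV[R]_n) : R := u (\1_Q).
(* The set function [m] weighted by p: additive, with total mass nu p S = L p. *)
pose nu p (Q : set 'rV[R]_n) : R := u (peval p * \1_Q).
have m_ge0 Q : 0 <= m Q.
  by apply: u0 => // x _; rewrite indicE; case: (_ \in _).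
have splitI Q A : (\1_Q : 'rV[R]_n -> R) = \1_(Q `&` A) + \1_(Q `\` A).
  have splitb (b c : bool) : b%:R = (b && c)%:R + (b && ~~ c)%:R :> R.
    by case: b c => [] []; rewrite ?addr0 ?add0r.
  apply/funext => x.
  by rewrite [LHS]indicE (splitb _ (x \in A)) -in_setI -in_setD.
have m_split Q A : m Q = m (Q `&` A) + m (Q `\` A).
  by rewrite /m (splitI Q A) uD.
have nu_split p Q A : nu p Q = nu p (Q `&` A) + nu p (Q `\` A).
  by rewrite /nu (splitI Q A) mulrDr uD//; exact: bounded_onM.
have m0 : m set0 = 0.
  by rewrite /m -[RHS](mul0r (u (\1_set0))) -uZ// scale0r; congr u;
    apply/funext => x; rewrite indic0.
pose B := basic_box R n; pose T := m S.
pose C k t := cell B m k 0 S 0 t; pose Xk k t := xget a0 (C k t).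
have CX k t : 0 <= t < T -> C k t (Xk k t).
  move=> tT; apply: xgetPex; apply/set0P/eqP => C0.
  have := @cell_gt0 R _ B m m_split k 0 S 0 t.
  by rewrite add0r -/(C k t) C0 m0 ltxx => /(_ tT).
have XS k t : 0 <= t < T -> S (Xk k t).
  by move=> /(CX k); exact: cell_sub.
(* A cell of [C k] lies in a single box of the subfamily [G], for [k] large. *)
have small (G : set nat) : (forall x, S x -> exists2 j, G j & B j x) ->
    exists K, forall k Q, (K <= k)%N -> Q `<=` S -> resolved B 0 k Q ->
      Q !=set0 -> exists2 j, G j & Q `<=` B j.
  move=> /(compact_basic_box cS)[K KG]; exists K => k Q Kk QS rQ [x Qx].
  have [j [jK Gj jx]] := KG x (QS _ Qx); exists j => //.
  have [|//|QB0] := rQ j; first by rewrite (leq_trans jK).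
  by have : (Q `&` B j) x by []; rewrite QB0.
(* Outside [0, T) the limit point is set to [a0], so that X maps into S everywhere. *)
have X_cvg t : exists l, S l /\
    (if t \in `[0, T[ then Xk k t @[k --> \oo] --> l else l = a0).
  case: (boolP (t \in `[0, T[)) => [|_]; last by exists a0.
  rewrite in_itv /= => tT.
  have : cvg (Xk k t @[k --> \oo]).
    apply: cauchy_cvg; apply: cauchy_exP => e e0.
    (* The boxes contained in some ball of radius e cover S, so the cell at depth [K] lies in such a
       ball, and with it all later points. *)
    have [|K hK] := small [set j | exists y : 'rV[R]_n, B j `<=` ball y e].
      move=> x Sx; have [j jx jb] := @basic_box_base R n x _ (nbhsx_ballx x e e0).
      by exists j => //; exists x.
    have [||||j [y jy] Cj] := hK K (C K t).
    - by [].
    - exact: cell_sub.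
    - exact: cell_resolved.
    - by exists (Xk K t); exact: CX.
    exists y; exists K => // k /= Kk; apply/jy/Cj.
    by apply: (cell_homo Kk); exact: CX.
  move=> /cvg_ex[/= l Xl]; exists l; split=> //.
  apply: (@closed_cvg _ _ \oo _ (Xk ^~ t) S _ _ l Xl).
    by apply: compact_closed => //; exact: norm_hausdorff.
  by apply: nearW => k; exact: XS.
have /choice[X Xl] := X_cvg.
have mT : measurable ([set` `[0, T[] : set R) by [].
(* Lebesgue measure is cut down to [0, T) to have finite total mass T = m S. *)
pose rho : {measure set (measurableTypeR R) -> \bar R} :=
  mrestr lebesgue_measure mT.
have mXk k (F : 'rV[R]_n -> R) :
    measurable_fun setT (fun t => if t \in `[0, T[ then F (Xk k t) else F a0).
  apply: measurable_fun_ifT => //.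
    apply: (measurable_fun_bool true) => //.
    by rewrite setTI [X in measurable X](_ : _ = [set` `[0, T[])// predeqE.
  exact: (@measurable_fun_cell _ _ _ _ _ _ _ _ (fun Q => F (xget a0 Q))).
have cXk (F : 'rV[R]_n -> R) t : continuous F ->
    (if t \in `[0, T[ then F (Xk k t) else F a0) @[k --> \oo] --> F (X t).
  move=> cF; have [_] := Xl t; case: (t \in `[0, T[) => [h|->]; last exact: cvg_cst.
  by apply: continuous_cvg => //; exact: cF.
have mX : measurable_fun setT (X : measurableTypeR R -> borelRn R n).
  apply: measurable_fun_borelRn => i.
  apply: (@measurable_fun_cvg _ _ _ _ (fun k t => if t \in `[0, T[ then
    (Xk k t) ord0 i else a0 ord0 i)) => [k|t _].
    exact: (mXk k (fun x => x ord0 i)).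
  by apply: (cXk (fun x => x ord0 i)); exact: coord_continuous.
have [mu muE] := @pushforward_measure _ _ _ (borelRn R n) R rho X mX.
exists mu; rewrite muE; split.
  rewrite /pushforward (_ : X @^-1` _ = set0) ?measure0//.
  by apply/seteqP; split=> // t /= /(_ (Xl t).1).
move=> p.
have XS_T : X @^-1` S = setT.
  by apply/seteqP; split=> // t _; exact: (Xl t).1.
have [M M0 pM] := peval_bounded p cS.
have mpX : measurable_fun setT (fun t => peval p (X t)).
  by apply: measurableT_comp mX; exact: measurable_peval.
have rhoT : (rho setT < +oo)%E.
  have -> : rho setT = lebesgue_measure (`[0, T[%classic : set R).
    by rewrite /rho /= /mrestr setTI.
  by rewrite -[T]add0r lebesgue_measure_cell ?ltry//; exact: m_ge0.
rewrite integral_pushforward//; last 3 first.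
- by apply/measurable_EFinP; exact: measurable_peval.
- rewrite XS_T; apply: (@bounded_integrable _ _ _ _ _ _ M) => //.
  by move=> t _; apply/pM/(Xl t).1.
- exact: compact_measurable_borelRn.
rewrite XS_T.
pose f_ k t := if t \in `[0, T[ then peval p (Xk k t) else peval p a0.
have cvg1 := @bounded_cvg_integral _ _ R rho setT f_ (peval p \o X) M
  measurableT rhoT (fun k => mXk k (peval p)).
have {}cvg1 : (\int[rho]_t (f_ k t)%:E @[k --> \oo] -->
    \int[rho]_t (peval p (X t))%:E)%E.
  apply: cvg1 => [k t _|t _].
    rewrite /f_; case: ifPn => [|_]; last exact: pM.
    by rewrite in_itv /= => tT; apply/pM/XS.
  by apply: cXk; exact: continuous_peval.
(* Dominated convergence gave the limit as the integral of p over X; it remains to identify the same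
   limit as L p. *)
suff cvg2 : (\int[rho]_t (f_ k t)%:E @[k --> \oo] --> (L p)%:E)%E.
  exact: (cvg_unique _ cvg1 cvg2).
have mulE (f g : 'rV[R]_n -> R) x : (f * g) x = f x * g x by [].
have scaleE c (f : 'rV[R]_n -> R) x : (c *: f) x = c * f x by [].
have nuS : nu p S = L p.
  rewrite -uL; apply: u_eq => //; first exact: bounded_onM.
  by move=> x Sx; rewrite mulE indicE mem_set// mulr1.
have F_eq k : (\int[rho]_t (f_ k t)%:E =
    \int[lebesgue_measure]_(t in `[0%R, (0 + T)%R[)
      (peval p (xget a0 (C k t)))%:E)%E.
  rewrite integral_mrestr; last by apply/measurable_EFinP; exact: mXk.
  by rewrite add0r; apply: eq_integral => t; rewrite inE /f_ /= => ->.
have key e : 0 < e -> exists K, forall k, (K <= k)%N ->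
    exists2 r, (\int[rho]_t (f_ k t)%:E = r%:E)%E & `|r - L p| <= e * T.
  move=> e0.
  (* By continuity, the boxes on which p oscillates by at most e cover S. *)
  have [|K hK] := small [set j | forall y z, B j y -> B j z ->
      `|peval p y - peval p z| <= e].
    move=> x Sx; have e20 : 0 < e / 2 by rewrite divr_gt0.
    have : \forall y \near x, `|peval p x - peval p y| < e / 2.
      have /cvgrPdist_lt := @continuous_peval R n p x.
      exact.
    move=> /basic_box_base[j jx jO]; exists j => // y z /jO /= xy /jO /= xz.
    rewrite -(subrKA (peval p x)); apply: (le_trans (ler_normD _ _)).
    by rewrite [`|peval p y - _|]distrC; lra.
  exists K => k Kk; rewrite F_eq -nuS.
  apply: (@integral_cell R _ B m m_ge0 m_split k 0 S 0
    (fun Q => peval p (xget a0 Q)) (nu p) e (nu_split p)) => Q QS rQ.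
  have [->|/set0P Q0] := eqVneq Q set0.
    rewrite m0 !mulr0 sub0r normrN /nu (_ : peval p * _ = 0 *: \1_set0).
      by rewrite uZ// mul0r normr0.
    by apply/funext => x; rewrite mulE scaleE indic0 mulr0 mul0r.
  have [j jG Qj] := hK k Q Kk QS rQ Q0.
  have Qx : Q (xget a0 Q) by apply: xgetPex.
  set c := peval p _.
  have pc x : Q x -> `|c - peval p x| <= e by move=> ?; apply: jG; exact: Qj.
  have bpI : bounded_on S (peval p * \1_Q) by exact: bounded_onM.
  have leI x (y z : R) : (Q x -> y <= z) ->
      y * \1_Q x <= z * \1_Q x.
    move=> yz; rewrite indicE; case: (boolP (x \in Q)); last by rewrite !mulr0.
    by rewrite inE !mulr1.
  (* Apply the monotone u to (c - e) 1_Q <= p 1_Q <= (c + e) 1_Q on S. *)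
  rewrite ler_norml; apply/andP; split.
    rewrite lerBrDr addrC -lerBrDr opprK -mulrDl /nu /m -uZ//.
    apply: u_le => //; first exact: bounded_onZ.
    move=> x Sx; rewrite mulE scaleE; apply: leI => /pc; rewrite ler_norml; lra.
  rewrite lerBlDr addrC -lerBlDr -mulrBl /nu /m -uZ//.
  apply: u_le => //; first exact: bounded_onZ.
  move=> x Sx; rewrite mulE scaleE; apply: leI => /pc; rewrite ler_norml; lra.
have T0 : 0 <= T by exact: m_ge0.
apply/fine_cvgP; split.
  have [K hK] := key 1 ltr01.
  by exists K => // k /= /hK[r -> _].
apply/cvgrPdist_le => e e0.
(* Dividing by T + 1 covers the case T = 0. *)
have [|K hK] := key (e / (T + 1)); first by rewrite divr_gt0// ltr_wpDl.
exists K => // k /= /hK[r rE re]; rewrite /= rE /= distrC; apply: (le_trans re).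
by rewrite mulrAC ler_pdivrMr ?ltr_wpDl// ler_wpM2l ?(ltW e0)//; lra.
Qed.

End Haviland.

(** * Dependence of the representing measures on the point *)

Lemma uniform_cvgP (R : realType) (T : choiceType) (S : set T)
    (f_ : nat -> T -> R) (g : T -> R) :
  {uniform S, f_ k @[k --> \oo] --> g} <->
  forall e, 0 < e -> \forall k \near \oo, forall x, S x -> `|g x - f_ k x| < e.
Proof.
split=> [fg e e0|fg P /uniform_nbhs[A [entA AP]]].
  have : nbhs (g : {uniform` S -> R}) [set h | forall y, S y -> ball (g y) e (h y)].
    apply/uniform_nbhs; exists [set xy | ball xy.1 e xy.2]; split=> //.
    by rewrite -entourage_ballE; exists e.
  by move=> /fg.
move: entA; rewrite -entourage_ballE => -[e /= e0 eA].
have := fg e e0; apply: filterS => k hk; apply: AP => y Sy; apply: eA.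
exact: hk.
Qed.

Section Represented.
Variables (R : realType) (n : nat) (S : set 'rV[R]_n).
Variables (Phi : {linear mpolyR R n -> mpolyR R n}) (x : 'rV[R]_n).
Variable mu : {measure set (borelRn R n) -> \bar R}.
Hypothesis cS : compact S.
Hypothesis muP : represents S Phi x mu.
Implicit Type A : set (borelRn R n).

Let mS : measurable (S : set (borelRn R n)).
Proof. exact: compact_measurable_borelRn. Qed.

Lemma represents_measureI A : measurable A -> mu (A `&` S) = mu A.
Proof.
move=> mA; have D0 : mu (A `\` S) = 0%E.
  apply: (@subset_measure0 _ _ _ mu _ (~` S)) => //.
  - exact: measurableD.
  - exact: measurableC.
  - exact: muP.1.
have E : mu A = (mu (A `\` S) + mu (A `&` S))%E := measureDI mu mA mS.
by rewrite E D0 add0e.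
Qed.

Lemma represents_mass : mu S = (peval (Phi 1) x)%:E.
Proof.
rewrite -muP.2; under eq_integral do rewrite peval1.
by rewrite integral_cst// mul1e.
Qed.

Lemma represents_setT : mu setT = (peval (Phi 1) x)%:E.
Proof. by rewrite -represents_mass -[RHS]represents_measureI ?setIid// -represents_measureI ?setTI. Qed.

Lemma represents_fin_num A : measurable A -> mu A \is a fin_num.
Proof.
move=> mA; rewrite ge0_fin_numE//; apply: (@le_lt_trans _ _ (mu setT)).
  by apply: le_measure; rewrite ?inE.
by rewrite represents_setT ltry.
Qed.

Let Sfin : (mu S < +oo)%E.
Proof. by rewrite represents_mass ltry. Qed.

Lemma represents_integrable (f : borelRn R n -> R) :
  measurable_fun (S : set (borelRn R n)) f -> bounded_on S f -> mu.-integrable S (EFin \o f).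
Proof. by move=> mf [M fM]; exact: (bounded_integrable mS Sfin mf fM). Qed.

Lemma represents_peval_integrable p : mu.-integrable S (EFin \o peval p).
Proof.
apply: represents_integrable; last exact: bounded_on_peval.
by apply: measurable_funTS; exact: measurable_peval.
Qed.

Lemma represents_integral_indic A : measurable A ->
  (\int[mu]_(y in S) (\1_A y)%:E)%E = (fine (mu A))%:E.
Proof.
by move=> mA; rewrite integral_indic// represents_measureI// fineK// represents_fin_num.
Qed.

(** Dominated convergence with bound 1. As [g] does not depend on x, this exhibits mu_x(A) as a
    pointwise limit of polynomials in x. *)
Lemma represents_approximable A (g : nat -> mpolyR R n) : measurable A ->
  (forall k y, S y -> 0 <= peval (g k) y <= 1) ->
  (forall y, S y -> peval (g k) y @[k --> \oo] --> (\1_A y : R)) ->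
  peval (Phi (g k)) x @[k --> \oo] --> fine (mu A).
Proof.
move=> mA g01 gA.
have := @bounded_cvg_integral _ _ R mu S (fun k => peval (g k)) (\1_A) 1 mS Sfin.
rewrite represents_integral_indic//.
under eq_fun do rewrite muP.2.
move=> /(_ _ _ _)/wrap[] //.
- by move=> k; apply: measurable_funTS; exact: measurable_peval.
- by move=> k y /(g01 k) /andP[h0 h1]; rewrite ger0_norm.
- by move=> /fine_cvgP[_].
Qed.

Lemma measurable_step_fun (s : step_function S) :
  measurable_fun (S : set (borelRn R n)) (step_fun s).
Proof.
apply: measurable_sum => i; apply: measurable_funM => //.
apply: measurable_funTS; apply: measurable_indic.
exact: (step_borel (s := s) i).1.
Qed.

Lemma bounded_step_fun (s : step_function S) : bounded_on S (step_fun s).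
Proof.
exists (\sum_(i < step_size s) `|step_coef i|) => y _.
apply: (le_trans (ler_norm_sum _ _ _)); apply: ler_sum => i _.
rewrite normrM ler_piMr// indicE.
by case: (_ \in _); rewrite ?normr1 ?normr0.
Qed.

(** When [mu] is the chosen measure at x, the right side is [step_integral (phi_star S Phi) s x]. *)
Lemma represents_step (s : step_function S) :
  (\int[mu]_(y in S) (step_fun s y)%:E)%E =
  (\sum_(i < step_size s) step_coef i * fine (mu (@step_set _ _ S s i)))%:E.
Proof.
rewrite -sumEFin; have mi i := (step_borel (s := s) i).1.
have int_i i : mu.-integrable S (fun y => (\1_(@step_set _ _ S s i) y)%:E).
  apply: represents_integrable; last exact: bounded_on_indic.
  by apply: measurable_funTS; exact: measurable_indic.
transitivity (\int[mu]_(y in S) (\sum_(i < step_size s)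
    ((step_coef i)%:E * (\1_(@step_set _ _ S s i) y)%:E)))%E.
  by apply: eq_integral => y _; rewrite -sumEFin.
rewrite integral_sum//; last by move=> i; exact: integrableZl.
by apply: eq_bigr => i _; rewrite integralZl// represents_integral_indic.
Qed.

Lemma represents_step_le (s : step_function S) p :
  (forall y, S y -> step_fun s y <= peval p y) ->
  \sum_(i < step_size s) step_coef i * fine (mu (@step_set _ _ S s i)) <=
  peval (Phi p) x.
Proof.
move=> sp; rewrite -lee_fin -represents_step -muP.2; apply: le_integral => //.
- exact: represents_integrable (measurable_step_fun s) (bounded_step_fun s).
- exact: represents_peval_integrable.
- by move=> y; rewrite inE lee_fin; exact: sp.
Qed.

Lemma represents_step_ge (s : step_function S) p :
  (forall y, S y -> peval p y <= step_fun s y) ->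
  peval (Phi p) x <=
  \sum_(i < step_size s) step_coef i * fine (mu (@step_set _ _ S s i)).
Proof.
move=> sp; rewrite -lee_fin -represents_step -muP.2; apply: le_integral => //.
- exact: represents_peval_integrable.
- exact: represents_integrable (measurable_step_fun s) (bounded_step_fun s).
- by move=> y; rewrite inE lee_fin; exact: sp.
Qed.

End Represented.

Section Preserver.
Variables (R : realType) (n : nat) (S : set 'rV[R]_n).
Variable Phi : {linear mpolyR R n -> mpolyR R n}.
Hypothesis cS : compact S.
Hypothesis PhiS : nonnegativity_preserver S Phi.

Lemma repr_measureP x : S x -> represents S Phi x (repr_measure S Phi x).
Proof.
move=> Sx; rewrite /repr_measure; case: pselect => [h|[]]; first exact: projT2 (cid h).
apply: (@haviland R n S (fun p => peval (Phi p) x)) => //.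
- by move=> p q; rewrite raddfD pevalD.
- by move=> c p; rewrite linearZ pevalZ.
- by move=> p /PhiS; exact.
- by exists x.
Qed.

Lemma phi_star_ge0 A x : 0 <= phi_star S Phi A x.
Proof. exact: fine_ge0. Qed.

(** Dynkin induction from the pi-system of approximable sets: the complement of A has mass Phi(1)(x)
    - mu_x(A), and a disjoint union is a limit of partial sums. *)
Lemma measurable_phi_star (A : set (borelRn R n)) : measurable A ->
  measurable_fun (S : set (borelRn R n)) (phi_star S Phi A).
Proof.
set G := [set A : set (borelRn R n) | measurable A /\ approximable S A].
have GE : @measurable _ (borelRn R n) = <<s G >>.
  apply/seteqP; split; first exact: measurable_borelRn_approximable.
  by apply: smallest_sub; [exact: sigma_algebra_measurable|move=> ? []].
have mP p : measurable_fun (S : set (borelRn R n)) (peval p).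
  by apply: measurable_funTS; exact: measurable_peval.
rewrite {1}GE; move: A; apply: (dynkin_induction GE).
- move=> A B [mA aA] [mB aB]; split; first exact: measurableI.
  exact: approximableI.
- apply: eq_measurable_fun (mP (Phi 1)) => x; rewrite inE => Sx.
  by rewrite /phi_star (represents_setT cS (repr_measureP Sx)).
- move=> A [mA [g g01 gA]].
  apply: (@measurable_fun_cvg _ (borelRn R n) R S
    (fun k => peval (Phi (g k)))) => // x Sx.
  exact: (represents_approximable cS (repr_measureP Sx)).
- move=> A mA hA.
  apply: eq_measurable_fun (measurable_funB (mP (Phi 1)) hA) => x; rewrite inE => Sx.
  have rx := repr_measureP Sx.
  have := represents_setT cS rx; rewrite -(setvU A) measureU//; last 2 first.
  + exact: measurableC.
  + by rewrite setICl.
  rewrite /phi_star -[X in (X + _)%E]fineK; last first.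
    by apply: (represents_fin_num cS rx); exact: measurableC.
  rewrite -[X in (_ + X)%E]fineK; last exact: (represents_fin_num cS rx).
  by rewrite -EFinD => -[e]; rewrite /= /phi_star -e addrK.
- move=> F mF tF hF.
  apply: (@measurable_fun_cvg _ (borelRn R n) R S
    (fun k x => \sum_(0 <= i < k) phi_star S Phi (F i) x)) => [k|x Sx].
    exact: measurable_sum.
  have rx := repr_measureP Sx.
  have mUF : measurable (\bigcup_k F k) by exact: bigcup_measurable.
  have : (\sum_(0 <= i < k) repr_measure S Phi x (F i) @[k --> \oo] -->
      (phi_star S Phi (\bigcup_k F k) x)%:E)%E.
    rewrite /phi_star fineK ?(represents_fin_num cS rx)//.
    exact: measure_semi_sigma_additive.
  move=> /fine_cvgP[_]; apply: cvg_trans; apply: near_eq_cvg; near=> k.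
  rewrite /= -sum_fine// => i _.
  exact: (represents_fin_num cS rx).
Unshelve. all: by end_near. Qed.

End Preserver.

(** * Uniform approximation by step functions, and the integral formula for Phi *)

Lemma exists_step_approx (R : realType) n (S : set 'rV[R]_n) (p : mpolyR R n) (d : R) :
  compact S -> 0 < d ->
  exists s : step_function S, forall x, S x -> `|peval p x - step_fun s x| <= d.
Proof.
move=> cS d0; have [M M0 pM] := peval_bounded p cS.
(* S is sliced by the values of p into layers of height d. Since 0 <= p + M <= 2M, [K] layers
   suffice, and the layer of x is the integer part of g x. *)
pose g x := (peval p x + M) / d; pose K := (Num.truncn (2 * M / d)).+1.
pose A (i : 'I_K) : set (borelRn R n) :=
  S `&` g @^-1` [set t | i%:R <= t < i.+1%:R].
have bA i : borel_subset S (A i).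
  split; last exact: subIsetl.
  apply: measurableI; first exact: compact_measurable_borelRn.
  have -> : [set t : R | i%:R <= t < i.+1%:R] = [set` `[i%:R, i.+1%:R[].
    by apply/seteqP; split=> t /=; rewrite in_itv.
  have mg : measurable_fun [set: borelRn R n] g.
    apply: measurable_funM => //; apply: measurable_funD => //.
    exact: measurable_peval.
  by rewrite -[X in measurable X]setTI; exact: mg.
have tA : trivIset setT A.
  move=> i j _ _ [x [[Sx /= gi] [_ /= gj]]]; apply/val_inj => /=.
  have g0 : 0 <= g x by move: gi => /andP[+ _]; apply: le_trans.
  by move: gi gj; rewrite -!truncn_eq// => /eqP <- /eqP <-.
exists (StepFunction (fun i => i%:R * d - M) bA tA) => x Sx.
have /[!ler_norml]/andP[p1 p2] := pM x Sx.
have g0 : 0 <= g x by rewrite divr_ge0// ?(ltW d0)//; lra.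
have gK : (Num.truncn (g x) < K)%N.
  by rewrite ltnS; apply: le_truncn; rewrite ler_pM2r ?invr_gt0//; lra.
pose i0 := Ordinal gK.
have Ai i : A i x <-> i = i0.
  split=> [[_ /= gi]|->].
    by apply/val_inj/esym/eqP => /=; rewrite truncn_eq.
  by split=> //=; exact: truncn_itv.
rewrite /step_fun /= (bigD1 i0)//= big1 ?addr0; last first.
  move=> i ii0; rewrite indicE memNset ?mulr0// => /Ai ii.
  by rewrite ii eqxx in ii0.
rewrite indicE mem_set ?mulr1; last exact/Ai.
have /andP[] := truncn_itv g0; rewrite /g.
set k := Num.truncn _; have -> : k.+1%:R = k%:R + 1 :> R by rewrite -natr1.
rewrite ler_pdivlMr// ltr_pdivrMr// => h1 h2.
by apply/andP; split; lra.
Qed.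

Theorem theorem6p3 (R : realType) (n : nat) (S : set 'rV[R]_n)
    (Phi : {linear mpolyR R n -> mpolyR R n}) :
  compact S -> zariski_dense S -> nonnegativity_preserver S Phi ->
  let m := phi_star S Phi in
  [/\ forall A, borel_subset S A ->
        (forall x, S x -> 0 <= m A x) /\ measurable_fun (S : set (borelRn R n)) (m A),
      forall (p : mpolyR R n) (s : nat -> step_function S),
        (exists q : mpolyR R n, forall j x, S x ->
           `|step_fun (s j) x| <= peval q x) ->
        (forall x, S x -> step_fun (s j) x @[j --> \oo] --> peval p x) ->
        forall x, S x ->
          step_integral m (s j) x @[j --> \oo] --> peval (Phi p) x,
      forall p : mpolyR R n, exists s : nat -> step_function S,
        {uniform S, step_fun (s j) @[j --> \oo] --> peval p} &
      forall (p : mpolyR R n) (s : nat -> step_function S),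
        {uniform S, step_fun (s j) @[j --> \oo] --> peval p} ->
        {uniform S, step_integral m (s j) @[j --> \oo] --> peval (Phi p)}].
Proof.
move=> cS _ PhiS m; have mS := compact_measurable_borelRn cS.
split=> [A [mA _]|p s [q sq] sp x Sx|p|p s].
- by split=> [x _|]; [exact: phi_star_ge0|exact: measurable_phi_star].
- have rx := repr_measureP cS PhiS Sx.
  (* A bound of q on the compact S serves as a constant dominating function. *)
  have [M _ qM] := peval_bounded q cS.
  have Sfin : (repr_measure S Phi x S < +oo)%E.
    by rewrite (represents_mass cS rx) ltry.
  have := @bounded_cvg_integral _ _ R (repr_measure S Phi x) S
    (fun j => step_fun (s j)) (peval p) M mS Sfin.
  rewrite rx.2; under eq_fun do rewrite (represents_step cS rx).
  move=> /(_ _ _ _)/wrap[] //.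
  + by move=> j; exact: measurable_step_fun.
  + move=> j y Sy; apply: (le_trans (sq j y Sy)).
    exact: le_trans (ler_norm _) (qM y Sy).
  + by move=> /fine_cvgP[_].
- have /choice[s sP] : forall j, exists s : step_function S,
      forall x, S x -> `|peval p x - step_fun s x| <= j.+1%:R^-1.
    by move=> j; apply: exists_step_approx.
  exists s; apply/uniform_cvgP => e e0.
  have : \forall j \near \oo, j.+1%:R^-1 < e by exact: near_infty_natSinv_lt (PosNum e0).
  by apply: filterS => j je x Sx; exact: le_lt_trans (sP j x Sx) je.
- move=> /uniform_cvgP sp; apply/uniform_cvgP => e e0.
  have [M M0 PM] := peval_bounded (Phi 1) cS.
  (* If p - d <= s_j <= p + d on S, integration gives an error of at most d Phi(1)(x) <= d M = e/2,
     uniformly in x. *)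
  pose d := e / (2 * M).
  have d0 : 0 < d by rewrite divr_gt0// mulr_gt0.
  have := sp d d0; apply: filterS => j js x Sx.
  have rx := repr_measureP cS PhiS Sx.
  have Phi_shift c : peval (Phi (p + c *: 1)) x = peval (Phi p) x + c * peval (Phi 1) x.
    by rewrite linearD linearZ pevalD pevalZ.
  have up : step_integral m (s j) x <= peval (Phi (p + d *: 1)) x.
    apply: (represents_step_le cS rx) => y Sy; rewrite pevalD pevalC.
    by have := js y Sy; rewrite ltr_norml => /andP[]; lra.
  have lo : peval (Phi (p + (- d) *: 1)) x <= step_integral m (s j) x.
    apply: (represents_step_ge cS rx) => y Sy; rewrite pevalD pevalC.
    by have := js y Sy; rewrite ltr_norml => /andP[]; lra.
  move: up lo; rewrite !Phi_shift => up lo.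
  have : d * peval (Phi 1) x <= d * M.
    by rewrite ler_pM2l//; exact: le_trans (ler_norm _) (PM x Sx).
  have -> : d * M = e / 2 by rewrite /d; field; rewrite gt_eqF.
  by rewrite ltr_norml => h; apply/andP; split; lra.
Qed.
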